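(* For every $k\in\mathbb Z$, the automorphism $\sigma$ of $\mathcal O$ sends $$\mathcal A_k\mapsto\mathcal A_{1-k},\qquad \mathcal B_k\mapsto\mathcal B_{-k},$$ and the antiautomorphism $\dagger$ of $\mathcal O$ sends $$\mathcal A_k\mapsto\mathcal A_k,\qquad \mathcal B_k\mapsto\mathcal B_{-k}.$$
   Context: $\mathbb F$ is a field of characteristic zero; all vector spaces and Lie algebras are over $\mathbb F$. $\mathbb F[t,t^{-1}]$ is the algebra of Laurent polynomials. $L(\mathfrak{gl}_2)=\mathfrak{gl}_2\otimes\mathbb F[t,t^{-1}]$ is the loop algebra, with Lie bracket $[u\otimes\varphi,v\otimes\phi]=[u,v]\otimes\varphi\phi$; its elements are viewed as $2\times 2$ matrices with entries in $\mathbb F[t,t^{-1}]$, with bracket $[x,y]=xy-yx$. For $x=\begin{pmatrix} a(t)&b(t)\\ c(t)&d(t)\end{pmatrix}\in L(\mathfrak{gl}_2)$ define $$\theta(x)=\begin{pmatrix} d(t^{-1})&c(t^{-1})\\ b(t^{-1})&a(t^{-1})\end{pmatrix},\quad \sigma(x)=\begin{pmatrix} d(t)&c(t)t\\ b(t)t^{-1}&a(t)\end{pmatrix},\quad \dagger(x)=\begin{pmatrix} a(t^{-1})&c(t^{-1})\\ b(t^{-1})&d(t^{-1})\end{pmatrix},$$ and $\varepsilon(x)=a(1)+d(1)\in\mathbb F$. An antiautomorphism of a Lie algebra $\mathfrak g$ is a vector space isomorphism $\alpha:\mathfrak g\to\mathfrak g$ with $\alpha([u,v])=[\alpha(v),\alpha(u)]$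 for all $u,v$. The maps $\theta,\sigma$ are automorphisms and $\dagger$ is an antiautomorphism of $L(\mathfrak{gl}_2)$; they mutually commute, and $\varepsilon:L(\mathfrak{gl}_2)\to\mathbb F$ is a Lie algebra homomorphism ($\mathbb F$ abelian). Let $\mathcal L=\ker\varepsilon$, and let $\mathcal O$ be the Lie algebra of all elements of $\mathcal L$ fixed by $\theta$. $\mathcal O$ is invariant under $\sigma$ and $\dagger$, and the restrictions of $\sigma,\dagger$ to $\mathcal O$ are again denoted $\sigma,\dagger$. For $k\in\mathbb Z$ define $$\mathcal A_k=\begin{pmatrix}0&t^k\\ t^{-k}&0\end{pmatrix},\qquad \mathcal B_k=\begin{pmatrix}t^k-1&0\\ 0&t^{-k}-1\end{pmatrix}.$$ *)

(* Defs.v *)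
From HB Require Import structures.
From mathcomp Require Import all_boot all_order all_algebra.
From mathcomp Require Import finmap ring.
From mathcomp.multinomials Require Import monalg.

Set Implicit Arguments.
Unset Strict Implicit.
Unset Printing Implicit Defensive.

Import GRing.Theory.
Local Open Scope ring_scope.

HB.mixin Record Lmodule_isLieAlgebra (R : comNzRingType) L
    of GRing.Lmodule R L := {
  lie_bracket : L -> L -> L;
  lie_linearl : forall y, linear (lie_bracket^~ y);
  lie_linearr : forall x, linear (lie_bracket x);
  liexx : forall x, lie_bracket x x = 0;
  lie_jacobi : forall x y z,
    lie_bracket x (lie_bracket y z) + lie_bracket y (lie_bracket z x)
      + lie_bracket z (lie_bracket x y) = 0
}.

#[short(type="lieAlgType")]
HB.structure Definition LieAlgebra (R : comNzRingType) :=
  { L of GRing.Lmodule R L & Lmodule_isLieAlgebra R L }.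

Record lie_hom (R : comNzRingType) (L M : lieAlgType R) := LieHom {
  lie_hom_fun :> L -> M;
  lie_hom_linear : linear lie_hom_fun;
  lie_hom_bracket : forall x y,
    lie_hom_fun (lie_bracket x y) =
    lie_bracket (lie_hom_fun x) (lie_hom_fun y)
}.

Record lie_aut (R : comNzRingType) (L : lieAlgType R) := LieAut {
  lie_aut_fun :> L -> L;
  lie_aut_linear : linear lie_aut_fun;
  lie_aut_bij : bijective lie_aut_fun;
  lie_aut_bracket : forall x y,
    lie_aut_fun (lie_bracket x y) =
    lie_bracket (lie_aut_fun x) (lie_aut_fun y)
}.

Record lie_antiaut (R : comNzRingType) (L : lieAlgType R) := LieAntiaut {
  lie_antiaut_fun :> L -> L;
  lie_antiaut_linear : linear lie_antiaut_fun;
  lie_antiaut_bij : bijective lie_antiaut_fun;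
  lie_antiaut_bracket : forall x y,
    lie_antiaut_fun (lie_bracket x y) =
    lie_bracket (lie_antiaut_fun y) (lie_antiaut_fun x)
}.

Section AbelianField.
Variable F : fieldType.

Definition abelian_lie : Type := F^o.
HB.instance Definition _ := GRing.Lmodule.on abelian_lie.

Definition abelian_bracket (_ _ : abelian_lie) : abelian_lie := 0.

Fact abelian_linearl y : linear (abelian_bracket^~ y).
Proof. by move=> a u v; rewrite /abelian_bracket scaler0 addr0. Qed.
Fact abelian_linearr x : linear (abelian_bracket x).
Proof. by move=> a u v; rewrite /abelian_bracket scaler0 addr0. Qed.
Fact abelian_xx x : abelian_bracket x x = 0. Proof. by []. Qed.
Fact abelian_jacobi x y z :
  abelian_bracket x (abelian_bracket y z)
  + abelian_bracket y (abelian_bracket z x)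
  + abelian_bracket z (abelian_bracket x y) = 0.
Proof. by rewrite /abelian_bracket !addr0. Qed.

HB.instance Definition _ := Lmodule_isLieAlgebra.Build F abelian_lie
  abelian_linearl abelian_linearr abelian_xx abelian_jacobi.
End AbelianField.

(* Multinomials only makes {malg F[K]} a ring when K has no nontrivial units,
   which excludes K = int; so the finitely supported families of coefficients
   {malg F[int]} are given the convolution product here. *)
Section Laurent.
Variable F : fieldType.

Definition laurent : Type := {malg F[int]}.
HB.instance Definition _ := GRing.Lmodule.on laurent.

Implicit Types (p q r : laurent) (i j k : int).

Definition lmonom k : laurent := << 1 *g k >>.

Definition lone : laurent := lmonom 0.

Definition lmul p q : laurent :=
  \sum_(i <- msupp p) \sum_(j <- msupp q) << p@_i * q@_j *g i + j >>.

Definition lsubst (A : lmodType F) (h : int -> A) p : A :=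
  \sum_(k <- msupp p) p@_k *: h k.

Lemma lsubstEw (A : lmodType F) (h : int -> A) (d : {fset int}) p :
  fsubset (msupp p) d -> lsubst h p = \sum_(k <- d) p@_k *: h k.
Proof.
move=> le; rewrite /lsubst; apply: big_fset_incl => // k _ /mcoeff_outdom ->.
by rewrite scale0r.
Qed.

Fact lsubst_linear (A : lmodType F) (h : int -> A) : linear (lsubst h).
Proof.
move=> a p q; set d := fsetU (msupp p) (msupp q).
have lep : fsubset (msupp p) d by apply: fsubsetUl.
have leq : fsubset (msupp q) d by apply: fsubsetUr.
have lepq : fsubset (msupp (a *: p + q)) d.
  apply: fsubset_trans (msuppD_le _ _) _; apply: fsetSU; exact: msuppZ_le.
rewrite (lsubstEw h lep) (lsubstEw h leq) (lsubstEw h lepq).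
rewrite scaler_sumr -big_split /=; apply: eq_bigr => k _.
by rewrite mcoeffD mcoeffZ scalerDl scalerA.
Qed.

HB.instance Definition _ (A : lmodType F) (h : int -> A) :=
  GRing.isLinear.Build F laurent A _ (lsubst h) (lsubst_linear h).

Lemma lmonomZ (c : F) k : << c *g k >> = c *: lmonom k.
Proof.
apply/malgP=> i; rewrite mcoeffZ !mcoeffU.
by case: (k == i); rewrite ?mulr1 // mulr0.
Qed.

Lemma laurentE p : p = lsubst lmonom p.
Proof.
rewrite {1}(monalgE p) /lsubst; apply: eq_bigr => k _; exact: lmonomZ.
Qed.

Lemma lsubstX (A : lmodType F) (h : int -> A) k : lsubst h (lmonom k) = h k.
Proof. by rewrite /lsubst msuppU oner_eq0 big_seq_fset1 mcoeffUU scale1r. Qed.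

Lemma lmulE p q : lmul p q = lsubst (fun i => lsubst (fun j => lmonom (i + j)) q) p.
Proof.
rewrite /lmul /lsubst; apply: eq_bigr => i _; rewrite scaler_sumr.
by apply: eq_bigr => j _; rewrite scalerA lmonomZ.
Qed.

Fact lmul_linearl q : linear (lmul^~ q).
Proof. by move=> a p r; rewrite !lmulE linearP. Qed.

Fact lmul_linearr p : linear (lmul p).
Proof.
move=> a q r; rewrite !lmulE /lsubst scaler_sumr -big_split; apply: eq_bigr.
move=> i _ /=; rewrite -!/(lsubst _ _) linearP scalerDr !scalerA.
by rewrite [a * _]mulrC.
Qed.

Lemma lmulX i j : lmul (lmonom i) (lmonom j) = lmonom (i + j).
Proof. by rewrite lmulE !lsubstX. Qed.

Lemma laurent_ind (P : laurent -> Prop) :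
  (forall a p q, P p -> P q -> P (a *: p + q)) -> (forall k, P (lmonom k)) ->
  forall p, P p.
Proof.
move=> PD PX p; rewrite (laurentE p) /lsubst.
have P0 : P 0.
  by have := PD (-1) _ _ (PX 0) (PX 0); rewrite scaleN1r addNr.
elim: (enum_fset (msupp p)) => [|k s IH]; first by rewrite big_nil.
by rewrite big_cons; apply: PD.
Qed.

Fact lmulC : commutative lmul.
Proof.
elim/laurent_ind => [a p q IHp IHq r|i].
  by rewrite lmul_linearl lmul_linearr IHp IHq.
elim/laurent_ind => [a p q IHp IHq|j].
  by rewrite lmul_linearl lmul_linearr IHp IHq.
by rewrite !lmulX addrC.
Qed.

Fact lmulA : associative lmul.
Proof.
elim/laurent_ind => [a p q IHp IHq r s|i].
  by rewrite !lmul_linearl IHp IHq.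
elim/laurent_ind => [a p q IHp IHq s|j].
  by rewrite !(lmul_linearr, lmul_linearl) IHp IHq.
elim/laurent_ind => [a p q IHp IHq|k].
  by rewrite !lmul_linearr IHp IHq.
by rewrite !lmulX addrA.
Qed.

Fact lmul1 : left_id lone lmul.
Proof.
elim/laurent_ind => [a p q IHp IHq|i]; first by rewrite lmul_linearr IHp IHq.
by rewrite lmulX add0r.
Qed.

Fact lmulDl : left_distributive lmul +%R.
Proof. by move=> p q r; have := lmul_linearl r 1 p q; rewrite !scale1r. Qed.

Fact lone_neq0 : lone != 0.
Proof.
apply/eqP=> /(congr1 (mcoeff 0)) /eqP.
by rewrite mcoeffUU mcoeff0 oner_eq0.
Qed.

HB.instance Definition _ := GRing.Zmodule_isComNzRing.Build laurent
  lmulA lmulC lmul1 lmulDl lone_neq0.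

Fact lscaleAl (a : F) p q : a *: (p * q) = (a *: p) * q.
Proof.
rewrite -[RHS]/(lmul _ _) -[p * q]/(lmul _ _).
by have := lmul_linearl q a p 0; rewrite [lmul 0 q](mul0r (q : laurent)) !addr0.
Qed.

HB.instance Definition _ := GRing.Lmodule_isLalgebra.Build F laurent lscaleAl.
HB.instance Definition _ := GRing.Lalgebra_isComAlgebra.Build F laurent.

Lemma lmonomD i j : lmonom (i + j) = lmonom i * lmonom j.
Proof. by rewrite -lmulX. Qed.

Lemma lmonom0 : lmonom 0 = 1.
Proof. by []. Qed.

Lemma lmonomK : lmonom 1 * lmonom (-1) = 1.
Proof. by rewrite -lmonomD subrr. Qed.

Fact lsubst_monoid_morphism (A : algType F) (h : int -> A) :
  h 0 = 1 -> (forall i j, h (i + j) = h i * h j) ->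
  monoid_morphism (lsubst h).
Proof.
move=> h0 hD; split; first by rewrite -lmonom0 lsubstX.
elim/laurent_ind => [a p q IHp IHq r|i].
  by rewrite mulrDl -scalerAl !linearP /= IHp IHq mulrDl scalerAl.
elim/laurent_ind => [a p q IHp IHq|j].
  by rewrite mulrDr -scalerAr !linearP /= IHp IHq mulrDr scalerAr.
by rewrite -lmonomD !lsubstX.
Qed.

(* p |-> p(t^-1) *)
Definition linv : laurent -> laurent := lsubst (fun k => lmonom (- k)).

(* p |-> p(1) *)
Definition leval1 : laurent -> F^o := lsubst (fun k => 1 ^ k : F^o).

HB.instance Definition _ := GRing.Linear.on linv.
HB.instance Definition _ := GRing.Linear.on leval1.

Fact linv_monoid_morphism : monoid_morphism linv.
Proof.
by apply: lsubst_monoid_morphism => // i j; rewrite opprD lmonomD.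
Qed.

Fact leval1_monoid_morphism : monoid_morphism leval1.
Proof.
by apply: lsubst_monoid_morphism => // i j; rewrite !exp1rz mulr1.
Qed.

HB.instance Definition _ :=
  GRing.isMonoidMorphism.Build laurent laurent linv linv_monoid_morphism.
HB.instance Definition _ :=
  GRing.isMonoidMorphism.Build laurent F^o leval1 leval1_monoid_morphism.

Lemma linvX k : linv (lmonom k) = lmonom (- k).
Proof. exact: lsubstX. Qed.

Lemma leval1X k : leval1 (lmonom k) = 1.
Proof. by rewrite /leval1 lsubstX exp1rz. Qed.

Lemma linvK : involutive linv.
Proof.
elim/laurent_ind => [a p q IHp IHq|k]; first by rewrite !linearP /= IHp IHq.
by rewrite !linvX opprK.
Qed.

Lemma leval1_linv p : leval1 (linv p) = leval1 p.
Proof.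
elim/laurent_ind: p => [a p q IHp IHq|k]; first by rewrite !linearP /= IHp IHq.
by rewrite linvX !leval1X.
Qed.

End Laurent.

Notation "''t^' k" := (@lmonom _ k)
  (at level 1, format "''t^' k") : ring_scope.

Definition mx2 (R : Type) (a b c d : R) : 'M[R]_2 :=
  \matrix_(i < 2, j < 2)
    (if i == ord0 then if j == ord0 then a else b
     else if j == ord0 then c else d).

Lemma mx2E (R : Type) (a b c d : R) :
  (mx2 a b c d 0 0 = a) * (mx2 a b c d 0 1 = b) *
  (mx2 a b c d 1 0 = c) * (mx2 a b c d 1 1 = d).
Proof. by rewrite !mxE. Qed.

Lemma mx2P (R : Type) (x y : 'M[R]_2) :
  x 0 0 = y 0 0 -> x 0 1 = y 0 1 -> x 1 0 = y 1 0 -> x 1 1 = y 1 1 -> x = y.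
Proof.
move=> e00 e01 e10 e11; apply/matrixP.
suff E i : i = 0 \/ i = 1 :> 'I_2.
  by move=> i j; case: (E i) => ->; case: (E j) => ->.
by case: i => -[|[|//]] lti; [left | right]; apply: val_inj.
Qed.

Section MatrixBracket.
Variable R : comNzRingType.
Implicit Types x y z : 'M[R]_2.

Definition mx_bracket x y : 'M[R]_2 := x *m y - y *m x.

Lemma mx_bracketE x y i j :
  mx_bracket x y i j =
  x i 0 * y 0 j + x i 1 * y 1 j - (y i 0 * x 0 j + y i 1 * x 1 j).
Proof.
rewrite /mx_bracket !mxE !big_ord_recl !big_ord0 !addr0.
by have -> : lift ord0 ord0 = 1 :> 'I_2 by apply: val_inj.
Qed.

Lemma mx_bracketC x y : mx_bracket x y = - mx_bracket y x.
Proof. by rewrite /mx_bracket opprB. Qed.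

Lemma mx_bracket_linearl y : linear (mx_bracket^~ y).
Proof.
move=> a x z; rewrite /mx_bracket mulmxDl mulmxDr -scalemxAl -scalemxAr.
by rewrite scalerBr opprD addrACA.
Qed.

Lemma mx_jacobi x y z :
  mx_bracket x (mx_bracket y z) + mx_bracket y (mx_bracket z x)
    + mx_bracket z (mx_bracket x y) = 0.
Proof.
have E u v w : mx_bracket u (mx_bracket v w) =
    u *m v *m w - u *m w *m v - (v *m w *m u - w *m v *m u).
  by rewrite /mx_bracket mulmxBr mulmxBl !mulmxA.
rewrite !E; move: (x *m y *m z) (x *m z *m y) (y *m z *m x) (y *m x *m z).
move: (z *m x *m y) (z *m y *m x) => a b c d e f.
by apply/matrixP => i j; rewrite !mxE; ring.
Qed.

Lemma mx_bracket_tr x y : (mx_bracket x y)^T = mx_bracket y^T x^T.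
Proof. by rewrite /mx_bracket linearB /= !trmx_mul. Qed.

(* S is conjugation by [mx2 0 t 1 0]. *)
Lemma mx_bracket_swap (t s : R) x y (S := fun x : 'M[R]_2 =>
    mx2 (x 1 1) (x 1 0 * t) (x 0 1 * s) (x 0 0)) :
  t * s = 1 -> S (mx_bracket x y) = mx_bracket (S x) (S y).
Proof.
rewrite /S => ts.
have tK (a b : R) : (a * t) * (b * s) = a * b.
  by rewrite mulrACA ts mulr1.
have tK' (a b : R) : (a * s) * (b * t) = a * b by rewrite mulrC tK mulrC.
by apply: mx2P; rewrite [RHS]mx_bracketE !mx2E mx_bracketE ?tK ?tK'; ring.
Qed.

Lemma mx_bracket_trace x y :
  mx_bracket x y 0 0 + mx_bracket x y 1 1 = 0.
Proof. by rewrite !mx_bracketE; ring. Qed.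

End MatrixBracket.

Lemma map_mx_bracket (R S : comNzRingType) (f : {rmorphism R -> S})
    (x y : 'M[R]_2) :
  map_mx f (mx_bracket x y) = mx_bracket (map_mx f x) (map_mx f y).
Proof. by rewrite /mx_bracket map_mxB !map_mxM. Qed.

Section LoopAlgebra.
Variable F : fieldType.

Definition loop_gl2 : Type := 'M[laurent F]_2.
HB.instance Definition _ := GRing.Zmodule.on loop_gl2.

Implicit Types x y z : loop_gl2.

(* 'M[laurent F]_2 is canonically a laurent F-module; loop_gl2 is the same
   group seen as an F-module. *)
Definition loop_scale (a : F) x : loop_gl2 := map_mx ( *:%R a) x.

Fact loop_scaleA a b x : loop_scale a (loop_scale b x) = loop_scale (a * b) x.
Proof. by apply/matrixP=> i j; rewrite !mxE scalerA. Qed.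
Fact loop_scale1 : left_id 1 loop_scale.
Proof. by move=> x; apply/matrixP=> i j; rewrite !mxE scale1r. Qed.
Fact loop_scaleDr : right_distributive loop_scale +%R.
Proof. by move=> a x y; apply/matrixP=> i j; rewrite !mxE scalerDr. Qed.
Fact loop_scaleDl x : {morph loop_scale^~ x : a b / a + b}.
Proof. by move=> a b; apply/matrixP=> i j; rewrite !mxE scalerDl. Qed.

HB.instance Definition _ := GRing.Zmodule_isLmodule.Build F loop_gl2
  loop_scaleA loop_scale1 loop_scaleDr loop_scaleDl.

Definition loop_bracket x y : loop_gl2 := mx_bracket x y.

Lemma loopPE (a : F) x y i j : (a *: x + y) i j = a *: x i j + y i j.
Proof. by rewrite mxE [X in X + _]mxE. Qed.

Lemma loop_scaleE (a : F) x :
  a *: x = (a%:A : laurent F) *: (x : 'M[laurent F]_2).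
Proof. by apply/matrixP=> i j; rewrite !mxE mulr_algl. Qed.

Fact loop_linearl y : linear (loop_bracket^~ y).
Proof. by move=> a x z; rewrite !loop_scaleE; apply: mx_bracket_linearl. Qed.

Fact loop_xx x : loop_bracket x x = 0.
Proof. exact: subrr. Qed.

Fact loop_linearr x : linear (loop_bracket x).
Proof.
move=> a y z; have opp u v : loop_bracket u v = - loop_bracket v u.
  exact: mx_bracketC.
by rewrite !(opp x) loop_linearl opprD scalerN.
Qed.

Fact loop_jacobi x y z :
  loop_bracket x (loop_bracket y z) + loop_bracket y (loop_bracket z x)
    + loop_bracket z (loop_bracket x y) = 0.
Proof. exact: mx_jacobi. Qed.

HB.instance Definition _ := Lmodule_isLieAlgebra.Build F loop_gl2
  loop_linearl loop_linearr loop_xx loop_jacobi.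

Definition theta_fun x : loop_gl2 :=
  mx2 (linv (x 1 1)) (linv (x 1 0))
      (linv (x 0 1)) (linv (x 0 0)).

Definition sigma_fun x : loop_gl2 :=
  mx2 (x 1 1)           (x 1 0 * 't^1)
      (x 0 1 * 't^(-1)) (x 0 0).

Definition dagger_fun x : loop_gl2 :=
  mx2 (linv (x 0 0)) (linv (x 1 0))
      (linv (x 0 1)) (linv (x 1 1)).

Definition eps_fun x : abelian_lie F := leval1 (x 0 0) + leval1 (x 1 1).

Fact theta_linear : linear theta_fun.
Proof. by move=> a x y; apply: mx2P; rewrite loopPE !mx2E loopPE linearP. Qed.

Fact sigma_linear : linear sigma_fun.
Proof.
by move=> a x y; apply: mx2P;
  rewrite loopPE !mx2E loopPE ?mulrDl ?scalerAl.
Qed.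

Fact dagger_linear : linear dagger_fun.
Proof. by move=> a x y; apply: mx2P; rewrite loopPE !mx2E loopPE linearP. Qed.

Fact eps_linear : linear eps_fun.
Proof.
move=> a x y; rewrite /eps_fun !loopPE !linearP /= scalerDr.
by rewrite addrACA.
Qed.

Fact thetaK : involutive theta_fun.
Proof. by move=> x; apply: mx2P; rewrite !mx2E linvK. Qed.

Fact sigmaK : involutive sigma_fun.
Proof.
move=> x; apply: mx2P; rewrite !mx2E // -mulrA ?lmonomK ?mulr1 //.
by rewrite ['t^(-1) * _]mulrC lmonomK mulr1.
Qed.

Fact daggerK : involutive dagger_fun.
Proof. by move=> x; apply: mx2P; rewrite !mx2E linvK. Qed.

Lemma theta_funE x :
  theta_fun x = let y := map_mx (@linv F) x in
  mx2 (y 1 1) (y 1 0 * 1) (y 0 1 * 1) (y 0 0).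
Proof. by rewrite /= !mxE !mulr1. Qed.

Fact theta_bracket x y :
  theta_fun (lie_bracket x y) = lie_bracket (theta_fun x) (theta_fun y).
Proof.
rewrite !theta_funE /= [map_mx _ _](map_mx_bracket (@linv F)).
exact/mx_bracket_swap/mulr1.
Qed.

Fact sigma_bracket x y :
  sigma_fun (lie_bracket x y) = lie_bracket (sigma_fun x) (sigma_fun y).
Proof. exact/mx_bracket_swap/lmonomK. Qed.

Lemma dagger_funE x : dagger_fun x = (map_mx (@linv F) x)^T.
Proof. by apply: mx2P; rewrite mx2E !mxE. Qed.

Fact dagger_bracket x y :
  dagger_fun (lie_bracket x y) = lie_bracket (dagger_fun y) (dagger_fun x).
Proof.
rewrite !dagger_funE [map_mx _ _](map_mx_bracket (@linv F)).
exact: mx_bracket_tr.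
Qed.

Fact eps_bracket x y :
  eps_fun (lie_bracket x y) = lie_bracket (eps_fun x) (eps_fun y).
Proof.
rewrite /eps_fun -raddfD /=.
by rewrite [X in leval1 X](mx_bracket_trace (R := laurent F) x y) raddf0.
Qed.

Definition theta : lie_aut loop_gl2 :=
  LieAut theta_linear (inv_bij thetaK) theta_bracket.
Definition sigma : lie_aut loop_gl2 :=
  LieAut sigma_linear (inv_bij sigmaK) sigma_bracket.
Definition dagger : lie_antiaut loop_gl2 :=
  LieAntiaut dagger_linear (inv_bij daggerK) dagger_bracket.
Definition eps : lie_hom loop_gl2 (abelian_lie F) :=
  LieHom eps_linear eps_bracket.

Definition calL : {pred loop_gl2} := [pred x | eps x == 0].

Definition calO_pred : {pred loop_gl2} := [pred x in calL | theta x == x].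

Lemma calOP x : reflect (eps x = 0 /\ theta x = x) (x \in calO_pred).
Proof.
by apply: (iffP andP) => -[]; [move=> /eqP ? /eqP ? | move=> /eqP ? /eqP ?].
Qed.

Fact calO_submod_closed : submod_closed calO_pred.
Proof.
split=> [|a x y /calOP[ex tx] /calOP[ey ty]]; apply/calOP.
  have := (eps_linear (-1) 0 0, theta_linear (-1) 0 0).
  by rewrite scaler0 addr0 !scaleN1r !addNr => -[].
split; first by rewrite [LHS]eps_linear [eps_fun x]ex [eps_fun y]ey scaler0 addr0.
by rewrite [LHS]theta_linear [theta_fun x]tx [theta_fun y]ty.
Qed.

HB.instance Definition _ :=
  GRing.isSubmodClosed.Build F loop_gl2 calO_pred calO_submod_closed.

Record calO := CalO {
  calO_val :> loop_gl2;
  calO_valP : calO_val \in calO_pred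
}.

HB.instance Definition _ := [isSub for calO_val].
HB.instance Definition _ := [Choice of calO by <:].
HB.instance Definition _ := [SubChoice_isSubLmodule of calO by <:].

Implicit Types u v w : calO.

Fact calO_bracket_subproof u v :
  lie_bracket (u : loop_gl2) (v : loop_gl2) \in calO_pred.
Proof.
case/calOP: (calO_valP u) (calO_valP v) => eu tu /calOP[ev tv].
by apply/calOP; rewrite !lie_hom_bracket !lie_aut_bracket tu tv.
Qed.

Definition calO_bracket u v : calO := CalO (calO_bracket_subproof u v).

Fact calO_linearl v : linear (calO_bracket^~ v).
Proof.
by move=> a u w; apply: val_inj; rewrite /= lie_linearl.
Qed.
Fact calO_linearr u : linear (calO_bracket u).
Proof.
by move=> a v w; apply: val_inj; rewrite /= lie_linearr.
Qed.
Fact calO_xx u : calO_bracket u u = 0.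
Proof. by apply: val_inj; rewrite /= liexx. Qed.
Fact calO_jacobi u v w :
  calO_bracket u (calO_bracket v w) + calO_bracket v (calO_bracket w u)
    + calO_bracket w (calO_bracket u v) = 0.
Proof.
by apply: val_inj; have := lie_jacobi (u : loop_gl2) (v : loop_gl2) (w : loop_gl2); rewrite /= => <-.
Qed.

HB.instance Definition _ := Lmodule_isLieAlgebra.Build F calO
  calO_linearl calO_linearr calO_xx calO_jacobi.

Lemma sigma_theta x : sigma (theta x) = theta (sigma x).
Proof.
by apply: mx2P; rewrite /= /sigma_fun /theta_fun !mx2E // rmorphM /= linvX ?opprK.
Qed.

Lemma dagger_theta x : dagger (theta x) = theta (dagger x).
Proof. by apply: mx2P; rewrite /= /dagger_fun /theta_fun !mx2E. Qed.

Fact sigmaO_subproof u : sigma (u : loop_gl2) \in calO_pred.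
Proof.
case/calOP: (calO_valP u) => eu tu; apply/calOP.
split; last by rewrite -sigma_theta tu.
by rewrite -eu /= /eps_fun !mx2E addrC.
Qed.

Fact daggerO_subproof u : dagger (u : loop_gl2) \in calO_pred.
Proof.
case/calOP: (calO_valP u) => eu tu; apply/calOP.
split; last by rewrite -dagger_theta tu.
by rewrite -eu /= /eps_fun !mx2E !leval1_linv.
Qed.

Definition sigmaO_fun u : calO := CalO (sigmaO_subproof u).
Definition daggerO_fun u : calO := CalO (daggerO_subproof u).

Fact sigmaO_linear : linear sigmaO_fun.
Proof.
move=> a u v; apply: val_inj.
exact: sigma_linear.
Qed.
Fact daggerO_linear : linear daggerO_fun.
Proof.
move=> a u v; apply: val_inj.
exact: dagger_linear.
Qed.
Fact sigmaOK : involutive sigmaO_fun.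
Proof. by move=> u; apply: val_inj; apply: sigmaK. Qed.
Fact daggerOK : involutive daggerO_fun.
Proof. by move=> u; apply: val_inj; apply: daggerK. Qed.
Fact sigmaO_bracket u v :
  sigmaO_fun (lie_bracket u v) = lie_bracket (sigmaO_fun u) (sigmaO_fun v).
Proof. by apply: val_inj; apply: sigma_bracket. Qed.
Fact daggerO_bracket u v :
  daggerO_fun (lie_bracket u v) = lie_bracket (daggerO_fun v) (daggerO_fun u).
Proof. by apply: val_inj; apply: dagger_bracket. Qed.

Definition sigmaO : lie_aut calO :=
  LieAut sigmaO_linear (inv_bij sigmaOK) sigmaO_bracket.
Definition daggerO : lie_antiaut calO :=
  LieAntiaut daggerO_linear (inv_bij daggerOK) daggerO_bracket.

Definition calA_mx (k : int) : loop_gl2 :=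
  mx2 0        't^k
      't^(- k) 0.

Definition calB_mx (k : int) : loop_gl2 :=
  mx2 ('t^k - 1) 0
      0          ('t^(- k) - 1).

Fact calA_subproof k : calA_mx k \in calO_pred.
Proof.
apply/calOP; split; first by rewrite /= /eps_fun !mx2E raddf0 addr0.
by apply: mx2P; rewrite /= !mx2E ?raddf0 ?linvX ?opprK.
Qed.

Fact calB_subproof k : calB_mx k \in calO_pred.
Proof.
apply/calOP; split.
  by rewrite /= /eps_fun !mx2E !raddfB /= !leval1X !subrr addr0.
by apply: mx2P; rewrite /= !mx2E ?raddf0 // rmorphB /= (rmorph1 (@linv F)) linvX ?opprK.
Qed.

Definition calA (k : int) : calO := CalO (calA_subproof k).
Definition calB (k : int) : calO := CalO (calB_subproof k).

End LoopAlgebra.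

Arguments calA F k : clear implicits.
Arguments calB F k : clear implicits.
Arguments sigmaO F : clear implicits.
Arguments daggerO F : clear implicits.

(* Main.v *)
Require Import Defs.
From mathcomp Require Import all_boot all_order all_algebra.
Import GRing.Theory.
Local Open Scope ring_scope.

(** Elements of O are equal as soon as their underlying matrices are, so each
    claim compares four Laurent polynomials. On the diagonal, both maps
    exchange t^k - 1 and t^-k - 1: sigma by swapping the two entries, dagger
    by substituting t^-1 for t. Off the diagonal, sigma multiplies the swapped
    entries by t and t^-1, which turns the exponents (k, -k) into
    (1 - k, k - 1); dagger both swaps and inverts them, so A_k is fixed. *)
Theorem lemma4p6 (F : fieldType) (F_char0 : [pchar F] =i pred0) :
  forall k : int,
    (sigmaO F (calA F k) = calA F (1 - k) /\
     sigmaO F (calB F k) = calB F (- k)) /\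
    (daggerO F (calA F k) = calA F k /\
     daggerO F (calB F k) = calB F (- k)).
Proof.
move=> k; split; split; apply: val_inj; apply: mx2P;
  rewrite /= !mx2E ?opprK ?mul0r ?raddf0 //.
- by rewrite -lmonomD addrC.
- by rewrite -lmonomD opprB.
- by rewrite linvX opprK.
- by rewrite linvX.
- by rewrite rmorphB rmorph1 /= linvX.
- by rewrite rmorphB rmorph1 /= linvX opprK.
Qed.
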